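(* Let $D$ be a division ring and let $n$ be a positive integer. If a matrix $N\in\mathrm{M}_n(D)$ is nilpotent, then $N$ can be expressed as a sum of two diagonalizable matrices in $\mathrm{M}_n(D)$. Moreover, the number $2$ is sharp: it cannot in general be replaced by $1$, i.e. there exist a division ring $D$, a positive integer $n$, and a nilpotent matrix in $\mathrm{M}_n(D)$ that is not diagonalizable.
   Context: $\mathrm{M}_n(D)$ is the ring of $n\times n$ matrices over $D$. A square matrix over $D$ is diagonalizable if it is similar over $D$ (conjugate by an invertible matrix over $D$) to a diagonal matrix with entries in $D$. Division rings may be commutative or noncommutative. *)

(* Defs.v *)
From HB Require Import structures.
From mathcomp Require Import all_boot all_order all_algebra.

Set Implicit Arguments.
Unset Strict Implicit.
Unset Printing Implicit Defensive.

Import GRing.Theory.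
Local Open Scope ring_scope.

(* [unitRingType] is nontrivial and not assumed commutative; when every nonzero
   element is a unit it is a division ring, possibly commutative. *)
Definition division_ring (D : unitRingType) : Prop :=
  forall x : D, x != 0 -> x \is a GRing.unit.

Definition nilpotent_mx (D : unitRingType) (n : nat) (A : 'M[D]_n) : Prop :=
  exists k : nat, A ^+ k = 0.

(* [unitmx] and [invmx] need commutative coefficients, so the two-sided
   inverse Q of the conjugating matrix P is given explicitly. *)
Definition similar_mx (D : unitRingType) (n : nat) (A B : 'M[D]_n) : Prop :=
  exists P Q : 'M[D]_n,
    [/\ P *m Q = 1%:M, Q *m P = 1%:M & P *m A *m Q = B].

(* The library's [diagonalizable] is restricted to matrices over a field. *)
Definition diagonalizable_mx (D : unitRingType) (n : nat) (A : 'M[D]_n) : Prop :=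
  exists d : 'rV[D]_n, similar_mx A (diag_mx d).

(* Main.v *)
(** A matrix ring over a division ring is von Neumann regular: Gaussian
    elimination brings any matrix to a diagonal idempotent. In a regular ring
    every nilpotent [N] is odd for some grading by Z/2, that is, there is an
    idempotent [E] with [E N + N E = N]; this replaces the Jordan form. Then
    [N = (E + E N) - (E - N E)] is a difference of two idempotents, and
    idempotent matrices are diagonalizable. *)
Require Import Defs.
From mathcomp Require Import all_boot all_order all_algebra perm.

Set Implicit Arguments.
Unset Strict Implicit.
Unset Printing Implicit Defensive.

Import GRing.Theory.
Local Open Scope ring_scope.

(** * Nilpotents in von Neumann regular rings *)

(* [g] is the identity of the corner ring [g R g] in which the induction runs.
   In terms of linear maps: grade the image [e = N X] of [N] by induction, with
   even part [f]. Choose an odd inner inverse [Y] of the restriction [M] of [N]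
   to the image and correct [X] to a right inverse [X'] of [N] on the image
   that agrees with [Y] on the image of [M]. The even part for [N] is then the
   lift by [X'] of the odd part of the image, plus a complement in [ker N] of
   the odd part of [ker M]. Elements are introduced by [exists x, x = _], as
   [mulrA] would unfold local definitions. *)
Lemma nilpotent_odd_corner (R : pzRingType) (k : nat) (g N : R) :
    (forall a : R, exists x, a * x * a = a) ->
    g * g = g -> g * N = N -> N * g = N -> N ^+ k.+1 = 0 ->
  exists E : R, [/\ E * E = E, g * E = E, E * g = E & E * N + N * E = N].
Proof.
move=> regR; elim: k g N => [|k IHk] g N gg gN Ng.
  rewrite expr1 => ->; exists 0.
  by split; rewrite ?mulr0 ?mul0r ?addr0.
move=> Nk.
have [X NXN gX] : exists2 X, N * X * N = N & g * X = X.
  have [X NXN] := regR N; exists (g * X); last by rewrite mulrA gg.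
  by rewrite mulrA Ng.
have [e eE] : exists x, x = N * X by eexists.
have eN : e * N = N by rewrite eE.
have ee : e * e = e by rewrite {2}eE mulrA eN.
have ge : g * e = e by rewrite eE mulrA gN.
have [M ME] : exists x, x = N * e by eexists.
have eM : e * M = M by rewrite ME mulrA eN.
have Me : M * e = M by rewrite ME -mulrA ee.
have Mexp j : M ^+ j.+1 = N ^+ j.+1 * e.
  elim: j => [|j IHj]; first by rewrite !expr1.
  by rewrite exprSr IHj -mulrA eM ME mulrA -exprSr.
(* Since [e = N X], the factor [e] absorbs one more power of [N]: the exponent drops by one on the
   image. *)
have Mk : M ^+ k.+1 = 0.
  by rewrite Mexp eE mulrA -exprSr Nk mul0r.
have [f [ff ef fe odd_f]] := IHk e M ee eM Me Mk.
have [f' f'E] : exists x, x = e - f by eexists.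
have f'f' : f' * f' = f'.
  by rewrite f'E mulrBl !mulrBr ee ef fe ff subrr subr0.
have ff' : f * f' = 0 by rewrite f'E mulrBr fe ff subrr.
have ef' : e * f' = f' by rewrite f'E mulrBr ee ef.
have f'e : f' * e = f' by rewrite f'E mulrBl ee fe.
have fM : f * M = M * f' by rewrite f'E mulrBr Me -{2}odd_f addrK.
have f'M : f' * M = M * f by rewrite f'E mulrBl eM -{1}odd_f addrC addKr.
have [Y [MYM eY Ye fY]] :
    exists Y, [/\ M * Y * M = M, e * Y = Y, Y * e = Y & f * Y = Y * f'].
  (* The odd part of any inner inverse will do: as [M] is odd, the even part of [Y0] contributes
     only an even term to [M Y0 M = M]. *)
  have [Y0 MY0M] := regR M; exists (f * Y0 * f' + f' * Y0 * f); split.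
  - transitivity (f' * (M * Y0 * M) * f + f * (M * Y0 * M) * f').
      by rewrite mulrDr mulrDl !mulrA f'M fM -!mulrA f'M fM.
    by rewrite MY0M f'M fM -!mulrA ff f'f' f'E -mulrDr subrKC Me.
  - by rewrite mulrDr !mulrA ef ef'.
  - by rewrite mulrDl -!mulrA fe f'e.
  - rewrite mulrDr mulrDl !mulrA ff ff' !mul0r addr0 -!mulrA f'f' ff'.
    by rewrite !mulr0 addr0.
(* [X] repairs the defect [e - N Y] of [Y] as a right inverse of [N]. This defect kills [M], so
   [X' M = Y M]. *)
have [X' X'E] : exists x, x = Y + X * (e - N * Y) by eexists.
have gY : g * Y = Y by rewrite -eY mulrA ge.
have gX' : g * X' = X' by rewrite X'E mulrDr gY mulrA gX.
have X'e : X' * e = X'.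
  by rewrite X'E mulrDl Ye -mulrA mulrBl ee -mulrA Ye.
have NX' : N * X' = e.
  by rewrite X'E mulrDr mulrA -eE mulrBr ee mulrA eN subrKC.
have NYM : N * Y * M = M by rewrite -[in N * Y]eY mulrA -ME MYM.
have X'M : X' * M = Y * M.
  by rewrite X'E mulrDl -mulrA mulrBl eM NYM subrr mulr0 addr0.
have [q qE] : exists x, x = Y * M by eexists.
(* [p] projects the image of [N] onto the kernel of [M]. It is even, because [Y M] is a product of
   two odd elements. *)
have [p pE] : exists x, x = e - q by eexists.
have eq_ : e * q = q by rewrite qE mulrA eY.
have fq : f * q = q * f by rewrite qE mulrA fY -mulrA f'M mulrA.
have ep : e * p = p by rewrite pE mulrBr ee eq_.
have pe : p * e = p by rewrite pE mulrBl ee qE -mulrA Me.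
have Np : N * p = 0 by rewrite pE mulrBr qE mulrA NYM -ME subrr.
have Mp : M * p = 0 by rewrite ME -mulrA ep Np.
have pp : p * p = p by rewrite {1}pE mulrBl ep qE -mulrA Mp mulr0 subr0.
have fp : f * p = p * f by rewrite pE mulrBr mulrBl fq ef fe.
have f'p : f' * p = p * f' by rewrite f'E mulrBr mulrBl fp ep pe.
(* [K] projects onto the kernel of [N] along the range of [X']. The agreement of [X'] with [Y] on
   the image of [M] gives [K e = p]. *)
have [K KE] : exists x, x = g - X' * N by eexists.
have KX' : K * X' = 0.
  by rewrite KE mulrBl gX' -mulrA NX' X'e subrr.
have NK : N * K = 0 by rewrite KE mulrBr Ng mulrA NX' eN subrr.
have gp : g * p = p by rewrite -ep mulrA ge.
have gK : g * K = K by rewrite KE mulrBr gg mulrA gX'.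
have Kg : K * g = K by rewrite KE mulrBl gg -mulrA Ng.
have Kp : K * p = p by rewrite KE mulrBl gp -mulrA Np mulr0 subr0.
have KK : K * K = K by rewrite {2}KE mulrBr Kg mulrA KX' mul0r subr0.
have Ke : K * e = p by rewrite KE mulrBl ge -mulrA -ME X'M -qE -pE.
have [u uE] : exists x, x = X' * f' * N by eexists.
have [v vE] : exists x, x = K - p * f' * K by eexists.
have NX'f' : N * (X' * f' * N) = f' * N by rewrite !mulrA NX' ef'.
have uu : u * u = u by rewrite {1}uE -mulrA uE NX'f' mulrA -(mulrA X') f'f'.
have Nv : N * v = 0 by rewrite vE mulrBr NK !mulrA Np !mul0r subrr.
have uv : u * v = 0 by rewrite uE -mulrA Nv mulr0.
have vu : v * u = 0.
  rewrite uE vE mulrBl !mulrA KX' -(mulrA (p * f')) KX'.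
  by rewrite !(mulr0, mul0r) subrr.
have Kv : K * v = v by rewrite vE mulrBr KK !mulrA Kp.
have pv : p * f' * v = 0.
  rewrite vE mulrBr -!mulrA (mulrA f' p) f'p -!mulrA.
  by rewrite (mulrA f' f') f'f' (mulrA p p) pp subrr.
have vv : v * v = v by rewrite {1}vE mulrBl Kv -(mulrA _ K) Kv pv subr0.
exists (u + v); split.
- by rewrite mulrDl !mulrDr uu uv vu vv addr0 add0r.
- by rewrite mulrDr uE vE mulrBr gK !mulrA gX' gp.
- by rewrite mulrDl uE vE mulrBl -!mulrA Ng Kg.
(* With [E = u + v], the identities [N E = f' N] and [E e = f] give
   [E N + N E = f N + f' N = e N]. *)
have NE : N * (u + v) = f' * N by rewrite mulrDr Nv addr0 uE NX'f'.
have Ee : (u + v) * e = f.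
  rewrite mulrDl uE vE mulrBl -!mulrA Ke -ME f'M mulrA X'M -qE f'p mulrA pp.
  by rewrite f'E mulrBr pe subKr -mulrDl pE subrKC ef.
by rewrite NE -{1}eN mulrA Ee -mulrDl f'E subrKC.
Qed.

Lemma nilpotent_odd (R : pzRingType) (k : nat) (N : R) :
    (forall a : R, exists x, a * x * a = a) -> N ^+ k = 0 ->
  exists2 E : R, E * E = E & E * N + N * E = N.
Proof.
move=> regR Nk.
have NSk : N ^+ k.+1 = 0 by rewrite exprS Nk mulr0.
have [E [EE _ _ oddE]] :=
  nilpotent_odd_corner regR (mulr1 1) (mul1r N) (mulr1 N) NSk.
by exists E.
Qed.

Lemma nilpotent_sub_idempotents (R : pzRingType) (k : nat) (N : R) :
    (forall a : R, exists x, a * x * a = a) -> N ^+ k = 0 ->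
  exists A B : R, [/\ A * A = A, B * B = B & N = A - B].
Proof.
move=> regR /(nilpotent_odd regR)[E EE oddE].
(* Multiply the oddness relation by [E] on the left. Every unwanted term in the two squares contains
   [E N E]. *)
have ENE : E * N * E = 0.
  have := congr1 ( *%R E) oddE.
  by rewrite mulrDr !mulrA EE -[RHS]addr0 => /addrI.
exists (E + E * N), (E - N * E); split.
- by rewrite mulrDl !mulrDr !mulrA EE ENE mul0r !addr0.
- have NENE : N * E * N * E = 0 by rewrite -!mulrA (mulrA E) ENE mulr0.
  by rewrite mulrBl !mulrBr !mulrA NENE ENE -[N * E * E]mulrA EE !subr0.
- by rewrite opprB [RHS]addrC addrA subrK addrC.
Qed.

(** * Gaussian elimination and regularity *)

(** Over a division ring this is the rank normal form up to the order of the diagonal entries, which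
    are then all 0 or 1. *)
Definition equiv_diag_idem (D : unitRingType) n (A : 'M[D]_n) : Prop :=
  exists P P' Q Q' : 'M[D]_n, exists d : 'rV[D]_n,
    [/\ P *m P' = 1%:M /\ P' *m P = 1%:M, Q *m Q' = 1%:M /\ Q' *m Q = 1%:M,
        diag_mx d *m diag_mx d = diag_mx d & P *m A *m Q = diag_mx d].

Lemma equiv_diag_idemP (D : unitRingType) n (P P' Q Q' A : 'M[D]_n) :
    P *m P' = 1%:M -> P' *m P = 1%:M -> Q *m Q' = 1%:M -> Q' *m Q = 1%:M ->
  equiv_diag_idem (P *m A *m Q) -> equiv_diag_idem A.
Proof.
move=> PP' P'P QQ' Q'Q [S [S' [T [T' [d [[SS' S'S] [TT' T'T] dd Ad]]]]]].
exists (S *m P), (P' *m S'), (Q *m T), (T' *m Q'), d; split=> //.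
- split; first by rewrite mulmxA -(mulmxA S) PP' mulmx1.
  by rewrite mulmxA -(mulmxA P') S'S mulmx1.
- split; first by rewrite mulmxA -(mulmxA Q) TT' mulmx1.
  by rewrite mulmxA -(mulmxA T') Q'Q mulmx1.
- by rewrite -Ad !mulmxA.
Qed.

(** [L] normalizes the pivot [x] to 1 and clears the column below it, [U] clears the rest of its
    row, and the hypothesis applies to the Schur complement [d - c x^-1 b]. *)
Lemma equiv_diag_idem_pivot (D : unitRingType) n (A : 'M[D]_(1 + n)) :
    (forall B : 'M[D]_n, equiv_diag_idem B) ->
    ulsubmx A 0 0 \is a GRing.unit -> equiv_diag_idem A.
Proof.
move=> IHn; set x := ulsubmx A 0 0 => Ux.
have ulA : ulsubmx A = x%:M by apply: mx11_scalar.
pose b := ursubmx A; pose c := dlsubmx A; pose d := drsubmx A.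
have [P [P' [Q [Q' [t [[PP' P'P] [QQ' Q'Q] tt Pt]]]]]] :=
  IHn (d - c *m (x^-1)%:M *m b).
have xV : (x^-1)%:M *m x%:M = 1%:M :> 'M_1 by rewrite -scalar_mxM mulVr.
have xK : x%:M *m (x^-1)%:M = 1%:M :> 'M_1 by rewrite -scalar_mxM divrr.
pose L := block_mx (x^-1)%:M 0 (- (c *m (x^-1)%:M)) 1%:M : 'M[D]_(1 + n).
pose L' := block_mx x%:M 0 c 1%:M : 'M[D]_(1 + n).
pose U := block_mx 1%:M (- ((x^-1)%:M *m b)) 0 1%:M : 'M[D]_(1 + n).
pose U' := block_mx 1%:M ((x^-1)%:M *m b) 0 1%:M : 'M[D]_(1 + n).
have idE : 1%:M = block_mx 1%:M 0 0 1%:M :> 'M[D]_(1 + n).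
  exact: scalar_mx_block.
apply: (@equiv_diag_idemP _ _ L L' U U').
- rewrite /L /L' mulmx_block !(mulmx0, mul0mx, mulmx1, mul1mx) xV idE.
  by rewrite !(addr0, add0r) mulNmx -mulmxA xV mulmx1 addNr.
- rewrite /L /L' mulmx_block !(mulmx0, mul0mx, mulmx1, mul1mx) xK idE.
  by rewrite !(addr0, add0r) subrr.
- rewrite /U /U' mulmx_block !(mulmx0, mul0mx, mulmx1, mul1mx) idE.
  by rewrite !(addr0, add0r) subrr.
- rewrite /U /U' mulmx_block !(mulmx0, mul0mx, mulmx1, mul1mx) idE.
  by rewrite !(addr0, add0r) addNr.
have -> : L *m A *m U = block_mx 1%:M 0 0 (d - c *m (x^-1)%:M *m b).
  rewrite -[A]submxK ulA -/b -/c -/d /L /U !mulmx_block.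
  rewrite !(mulmx0, mul0mx, mulmx1, mul1mx, addr0, add0r) xV.
  rewrite !mulNmx -(mulmxA c _ x%:M) xV mulmx1 mul1mx !addNr mul0mx add0r.
  by rewrite [- _ + d]addrC.
exists (block_mx 1%:M 0 0 P), (block_mx 1%:M 0 0 P').
exists (block_mx 1%:M 0 0 Q), (block_mx 1%:M 0 0 Q').
exists (row_mx (const_mx 1) t).
have diagE : diag_mx (row_mx (const_mx 1) t) =
    block_mx 1%:M 0 0 (diag_mx t) :> 'M[D]_(1 + n).
  by rewrite diag_mx_row diag_const_mx.
rewrite !diagE !mulmx_block !(mulmx0, mul0mx, mulmx1, mul1mx, addr0, add0r).
by rewrite PP' P'P QQ' Q'Q tt Pt idE.
Qed.

Lemma division_ring_equiv_diag_idem (D : unitRingType) n (A : 'M[D]_n) :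
  division_ring D -> equiv_diag_idem A.
Proof.
move=> divD; elim: n A => [|n IHn] A.
  exists 1%:M, 1%:M, 1%:M, 1%:M, 0.
  by split; try split; apply/matrixP => -[].
have [->|] := eqVneq A 0.
  exists 1%:M, 1%:M, 1%:M, 1%:M, 0; rewrite mulmx1 mulmx0 mul0mx.
  by split; rewrite ?raddf0 ?mulmx0 ?mulmx1.
case/matrix0Pn=> i [j Aij].
(* Transpositions, which are their own inverses, move the nonzero entry to the pivot position. *)
apply: (@equiv_diag_idemP _ _ (tperm_mx i 0) (tperm_mx i 0)
                              (tperm_mx j 0) (tperm_mx j 0)).
1-4: by rewrite -perm_mxM tperm2 perm_mx1.
rewrite -xrowE -xcolE.
apply: equiv_diag_idem_pivot => //; apply: divD.
by rewrite !mxE lshift0 !tpermR.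
Qed.

Lemma division_ring_mx_regular (D : unitRingType) n (A : 'M[D]_n) :
  division_ring D -> exists X : 'M[D]_n, A * X * A = A.
Proof.
move=> /(division_ring_equiv_diag_idem A)
  [P [P' [Q [Q' [d [[PP' P'P] [QQ' Q'Q] dd Ad]]]]]].
have -> : A = P' *m diag_mx d *m Q'.
  by rewrite -Ad !mulmxA P'P mul1mx -mulmxA QQ' mulmx1.
(* The idempotent [diag_mx d] has inner inverse 1; transport it through the equivalence. *)
exists (Q *m P).
change (P' *m diag_mx d *m Q' *m (Q *m P) *m (P' *m diag_mx d *m Q') =
        P' *m diag_mx d *m Q').
by rewrite !mulmxA -(mulmxA _ Q') Q'Q mulmx1 -(mulmxA _ P) PP' mulmx1
  -(mulmxA P') dd.
Qed.

(** * Diagonalizability *)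

(** The conjugate [h] of [A] is [f] times an invertible matrix, so the idempotents [h] and [f] have
    the same image. Then [w = h - f] squares to zero and [1 + w] conjugates [h] to [f]. *)
Lemma idempotent_mx_diagonalizable (D : unitRingType) n (A : 'M[D]_n) :
  division_ring D -> A *m A = A -> diagonalizable_mx A.
Proof.
move=> /(division_ring_equiv_diag_idem A)
  [P [P' [Q [Q' [d [[PP' P'P] [QQ' Q'Q] ff Ad]]]]]] AA.
set f := diag_mx d in ff Ad.
pose h := P *m A *m P'.
have hh : h *m h = h.
  by rewrite /h !mulmxA -(mulmxA _ P') P'P mulmx1 -(mulmxA P) AA.
have hE : h = f *m (Q' *m P').
  by rewrite -Ad /h !mulmxA -(mulmxA _ Q) QQ' mulmx1.
have fE : f = h *m (P *m Q).
  by rewrite -Ad /h !mulmxA -(mulmxA _ P') P'P mulmx1.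
have hf : h *m f = f by rewrite {1}fE mulmxA hh -fE.
have fh : f *m h = h by rewrite {1}hE mulmxA ff -hE.
have [w wE] : exists x, x = h - f by eexists.
have ww : w *m w = 0.
  by rewrite wE mulmxBl !mulmxBr hh hf fh ff subrr.
have UV : (1%:M + w) *m (1%:M - w) = 1%:M.
  by rewrite mulmxDl !mulmxBr ww !mulmx1 mul1mx subr0 subrK.
have VU : (1%:M - w) *m (1%:M + w) = 1%:M.
  by rewrite mulmxBl !mulmxDr ww !mulmx1 mul1mx addr0 addrK.
exists d, ((1%:M + w) *m P), (P' *m (1%:M - w)); split.
- by rewrite mulmxA -(mulmxA _ P) PP' mulmx1 UV.
- by rewrite mulmxA -(mulmxA P') VU mulmx1.
have -> : (1%:M + w) *m P *m A *m (P' *m (1%:M - w)) =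
    (1%:M + w) *m h *m (1%:M - w) by rewrite /h !mulmxA.
have -> : (1%:M + w) *m h = h.
  by rewrite mulmxDl mul1mx wE mulmxBl hh fh subrr addr0.
by rewrite mulmxBr mulmx1 wE mulmxBr hh hf subKr.
Qed.

Lemma diagonalizable_mxN (D : unitRingType) n (A : 'M[D]_n) :
  diagonalizable_mx A -> diagonalizable_mx (- A).
Proof.
case=> d [P [Q [PQ QP PAQ]]]; exists (- d), P, Q; split=> //.
by rewrite mulmxN mulNmx PAQ raddfN.
Qed.

(** Squaring to zero passes to the diagonal form, whose entries vanish because a division ring has
    no nonzero nilpotents. This yields the sharpness example. *)
Lemma diagonalizable_mx_sqr_eq0 (D : unitRingType) n (A : 'M[D]_n) :
  division_ring D -> diagonalizable_mx A -> A *m A = 0 -> A = 0.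
Proof.
move=> divD [d [P [Q [PQ QP PAQ]]]] AA.
suff d0 : d = 0.
  have -> : A = Q *m (P *m A *m Q) *m P.
    by rewrite !mulmxA QP mul1mx -mulmxA QP mulmx1.
  by rewrite PAQ d0 raddf0 mulmx0 mul0mx.
have dd : diag_mx d *m diag_mx d = 0.
  by rewrite -PAQ !mulmxA -(mulmxA _ Q) QP mulmx1 -(mulmxA P) AA mulmx0 mul0mx.
apply/rowP=> i; rewrite [RHS]mxE; apply/eqP/negPn/negP => /divD Udi.
move/matrixP/(_ i i): dd; rewrite mul_diag_mx !mxE eqxx mulr1n => dd.
by move: (Udi); rewrite -(mulKr Udi (d 0 i)) dd mulr0 unitr0.
Qed.

Theorem theorem2p8 :
  (forall (D : unitRingType) (n : nat) (N : 'M[D]_n),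
     division_ring D -> (0 < n)%N -> nilpotent_mx N ->
     exists A B : 'M[D]_n,
       [/\ diagonalizable_mx A, diagonalizable_mx B & N = A + B])
  /\
  (exists (D : unitRingType) (n : nat) (N : 'M[D]_n),
     [/\ division_ring D, (0 < n)%N, nilpotent_mx N & ~ diagonalizable_mx N]).
Proof.
split=> [D n N divD _ [k Nk]|].
  have regM (A : 'M[D]_n) := division_ring_mx_regular A divD.
  have [A [B [AA BB NE]]] := nilpotent_sub_idempotents regM Nk.
  exists A, (- B); split=> //; first exact: idempotent_mx_diagonalizable.
  exact/diagonalizable_mxN/idempotent_mx_diagonalizable.
pose N : 'M[rat]_2 := delta_mx 0 1.
have NN : N *m N = 0 by rewrite mul_delta_mx_0.
have divQ : division_ring rat by move=> x; rewrite unitfE.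
exists rat, 2%N, N; split=> //; first by exists 2%N.
move=> /(diagonalizable_mx_sqr_eq0 divQ)/(_ NN)/matrixP/(_ 0 1).
by rewrite !mxE.
Qed.
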